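(* Let $k$ be a field of characteristic $0$. Suppose $f:X\to\mathbb{P}^1_k$ is a covering with decomposition $f=f_1\circ\cdots\circ f_r$ into indecomposable coverings $f_i:X_i\to X_{i-1}$ ($X_0=\mathbb{P}^1_k$, $X_r=X$), whose monodromy groups $\Gamma_i$ each have a unique minimal normal subgroup, the quotient by which is solvable. Let $\tilde f$ be the Galois closure of $f$, and suppose $h:Y\to\mathbb{P}^1_k$ is a minimal subcover of $\tilde f$ with nonsolvable monodromy group $\Gamma$, such that $\Gamma/M$ is solvable for every nontrivial normal subgroup $M$ of $\Gamma$. Then: (1) there exists a subcover $f'$ of $f$ that has the same Galois closure as $h$; moreover $f'=f_1'\circ f_2'$ with $\mathrm{Mon}(f_1')$ solvable and $f_2'$ indecomposable; (2) if moreover $\Gamma_1,\dots,\Gamma_r$ are nonsolvable, then $f'$ (with the property in (1)) can be taken indecomposable.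
   Context: All coverings are over $k$ (nonconstant morphisms of smooth irreducible projective curves), and monodromy group means arithmetic monodromy group: for a covering $c:Z\to W$, the Galois group of the Galois closure of $k(Z)/k(W)$ acting on cosets of the subgroup fixing $k(Z)$. A covering is indecomposable if in every decomposition into two coverings one has degree $1$. The Galois closure $\tilde c$ of $c:Z\to\mathbb{P}^1$ is the covering corresponding to the Galois closure of $k(Z)/k(t)$. A subcover of $g$ is a covering $h$ with $g=h\circ h'$ for a covering $h'$. ''$h$ is a minimal subcover of $\tilde f$ with nonsolvable monodromy'' means $h$ is a subcover of $\tilde f$ with nonsolvable monodromy group, and every subcover of $h$ not equivalent to $h$ has solvable monodromy group. *)

(* Defs.v *)
From mathcomp Require Import all_boot all_order all_fingroup all_algebra.
From mathcomp Require Import all_solvable all_field.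

Set Implicit Arguments.
Unset Strict Implicit.
Unset Printing Implicit Defensive.

(* Smooth irreducible projective curves over k with nonconstant k-morphisms   *)
(* are encoded by their function fields: the category is anti-equivalent to   *)
(* that of function fields of one variable over k with k-embeddings.  Every   *)
(* curve below comes with a covering of the projective line, so it is a       *)
(* finite extension of k(t).  The field k need not be algebraically closed in *)
(* that extension: curves are irreducible over k, not geometrically so.       *)
Notation ratfun k := {fraction {poly k}}.
Notation curve k := (fieldExtType (ratfun k)).

Definition P1 (k : fieldType) : curve k := (ratfun k)^o.

(* A covering Z -> W is the pullback embedding k(W) -> k(Z), hence the        *)
(* reversal of arguments here and in the composition c1 o c2.                 *)
Definition covering (k : fieldType) (Z W : curve k) : Type := 'AHom(W, Z).

Definition cov_comp (k : fieldType) (Z U W : curve k)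
    (c1 : covering U W) (c2 : covering Z U) : covering Z W := (c2 \o c1)%AF.

Definition cov_field (k : fieldType) (Z W : curve k) (c : covering Z W) :
    {subfield Z} := (c @: {:W})%AS.

Definition degree (k : fieldType) (Z W : curve k) (c : covering Z W) : nat :=
  \dim_(cov_field c) {:Z}.

Definition indecomposable (k : fieldType) (Z W : curve k)
    (c : covering Z W) : Prop :=
  forall (U : curve k) (c1 : covering U W) (c2 : covering Z U),
    c = cov_comp c1 c2 -> degree c1 = 1%N \/ degree c2 = 1%N.

Definition subcover (k : fieldType) (Y X W : curve k)
    (h : covering Y W) (g : covering X W) : Prop :=
  exists h' : covering X Y, g = cov_comp h h'.

Definition cov_equiv (k : fieldType) (Y1 Y2 W : curve k)
    (h1 : covering Y1 W) (h2 : covering Y2 W) : Prop :=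
  exists u : 'AHom(Y2, Y1), bijective u /\ h1 = cov_comp h2 u.

(* MathComp's [galois] and ['Gal(_ / _)] live in a splitting field over the   *)
(* base k(t); N / W is read inside such an ambient field L via an embedding j *)
(* of k(N).  None of the notions below depends on the choice of L and j.      *)
Definition galois_in (k : fieldType) (N W : curve k) (g : covering N W)
    (L : splittingFieldType (ratfun k)) (j : 'AHom(N, L)) : Prop :=
  galois (j @: cov_field g)%AS (j @: {:N})%AS.

Definition galois_cover (k : fieldType) (N W : curve k)
    (g : covering N W) : Prop :=
  exists (L : splittingFieldType (ratfun k)) (j : 'AHom(N, L)), galois_in g j.

Definition galois_closure (k : fieldType) (N Z W : curve k)
    (c : covering Z W) (g : covering N W) : Prop :=
  [/\ galois_cover g, subcover c g &
      forall (N' : curve k) (g' : covering N' W),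
        galois_cover g' -> subcover c g' -> subcover g g'].

Definition same_galois_closure (k : fieldType) (Z1 Z2 W : curve k)
    (c1 : covering Z1 W) (c2 : covering Z2 W) : Prop :=
  exists (N : curve k) (g : covering N W),
    galois_closure c1 g /\ galois_closure c2 g.

(* G is the monodromy group of c, as an abstract group; the action on the     *)
(* cosets of the subgroup fixing k(Z) is not recorded.                        *)
Definition is_monodromy (k : fieldType) (Z W : curve k) (c : covering Z W)
    (gT : finGroupType) (G : {group gT}) : Prop :=
  exists (N : curve k) (g : covering N W)
         (L : splittingFieldType (ratfun k)) (j : 'AHom(N, L)),
    galois_closure c g /\
    G \isog 'Gal((j @: {:N})%AS / (j @: cov_field g)%AS).

Definition solvable_monodromy (k : fieldType) (Z W : curve k)
    (c : covering Z W) : Prop :=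
  exists (gT : finGroupType) (G : {group gT}),
    is_monodromy c G /\ solvable G.

Definition nonsolvable_monodromy (k : fieldType) (Z W : curve k)
    (c : covering Z W) : Prop :=
  exists (gT : finGroupType) (G : {group gT}),
    is_monodromy c G /\ ~~ solvable G.

(* MathComp's [minnormal M G] does not require M to be contained in G. *)
Definition minimal_normal (gT : finGroupType) (M G : {group gT}) : bool :=
  [min M of H | (H :!=: 1) && (H <| G)]%g.

Definition unique_minnormal_solvable_quotient (gT : finGroupType)
    (G : {group gT}) : Prop :=
  exists M : {group gT},
    [/\ minimal_normal M G,
        forall M' : {group gT}, minimal_normal M' G -> M' = M &
        solvable (G / M)].

Definition minimal_nonsolvable_subcover (k : fieldType) (Y X W : curve k)
    (h : covering Y W) (g : covering X W) : Prop :=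
  [/\ subcover h g, nonsolvable_monodromy h &
      forall (Y' : curve k) (h' : covering Y' W),
        subcover h' h -> ~ cov_equiv h' h -> solvable_monodromy h'].

(* [decomposition Z W]: a nonempty sequence of coverings f_1, ..., f_r with   *)
(* f_1 o ... o f_r : Z -> W.                                                  *)
Inductive decomposition (k : fieldType) (Z : curve k) : curve k -> Type :=
| DecLast (W : curve k) : covering Z W -> decomposition Z W
| DecCons (W U : curve k) :
    covering U W -> decomposition Z U -> decomposition Z W.

Fixpoint dec_comp (k : fieldType) (Z W : curve k)
    (d : decomposition Z W) : covering Z W :=
  match d in decomposition _ W0 return covering Z W0 with
  | DecLast _ c => c
  | DecCons _ _ c d' => cov_comp c (dec_comp d')
  end.

Fixpoint dec_all (k : fieldType)
    (P : forall Z W : curve k, covering Z W -> Prop) (Z W : curve k)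
    (d : decomposition Z W) : Prop :=
  match d with
  | DecLast _ c => P _ _ c
  | DecCons _ _ c d' => P _ _ c /\ dec_all P d'
  end.

Definition solvable_then_indecomposable (k : fieldType) (Z W : curve k)
    (c : covering Z W) : Prop :=
  exists (U : curve k) (c1 : covering U W) (c2 : covering Z U),
    [/\ c = cov_comp c1 c2, solvable_monodromy c1 & indecomposable c2].

(* Main.v *)
Require Import Defs.
From HB Require Import structures.
From mathcomp Require Import all_boot all_order all_fingroup all_algebra.
From mathcomp Require Import all_solvable all_field.

(* Let A be the Galois group of the closure of f, A = H_0 > ... > H_r the chain
   of subgroups attached to f_1 o ... o f_r, D the subgroup attached to h and N
   the core of D in A, so that Mon(h) = A / N.  All that is used of Mon(h) and
   of the Mon(f_i) is that their proper quotients are solvable.  Let i be last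
   such that the core C of H_(i-1) is not contained in N.  The kernel of H_(i-1)
   acting on H_(i-1)/H_i contains C :&: N (otherwise C / (C :&: N), hence A / N,
   would be solvable), and a commutator argument then gives that the core of
   N H_i is still N.  Hence the core of N H_j drops to N at some first j, and f'
   is the covering attached to N H_j, which is maximal in N H_(j-1); the core of
   the latter is not contained in N, so its covering has solvable monodromy.  If
   N H_(j-1) = A and N H_j is a proper subgroup with core not contained in N,
   then Mon(f_j) is a quotient of a proper quotient of A / N, hence solvable;
   so when all Mon(f_j) are nonsolvable, j can be taken with N H_(j-1) = A.  *)

Set Implicit Arguments.
Unset Strict Implicit.
Unset Printing Implicit Defensive.
Import GRing.Theory GroupScope.

(** * Finite groups *)

Section GroupLemmas.
Variable gT : finGroupType.
Implicit Types (A B C G J K N P Q X Y : {group gT}).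

(** When [X] normalises [K], this says that the image of [X] modulo [K] is solvable; with derived
    series, varying [K] or [X] is a matter of inclusions. *)
Definition solvable_mod (K : {set gT}) X := exists n, X^`(n) \subset K.

(** For [K] normal in [P]: every proper quotient of [P / K] is solvable. *)
Definition proper_solvable_mod P K := forall J, J <| P -> ~~ (J \subset K) ->
  solvable_mod (K <*> J) P.

Lemma solvable_quo_der G J : J <| G -> solvable (G / J) <-> solvable_mod J G.
Proof.
move=> nJG; have nJ := normal_norm nJG; split.
  case/derivedP=> n; rewrite -quotient_der // => h; exists n.
  by rewrite -quotient_sub1 ?h // (subset_trans _ nJ) ?der_sub.
case=> n h; apply/derivedP; exists n; rewrite -quotient_der //; apply/trivgP.
by rewrite quotient_sub1 // (subset_trans _ nJ) ?der_sub.
Qed.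

(** Modulo [N], the images of [X] and [Y] lie in those of [J1] and [J2]. *)
Lemma commg_joing N J1 J2 (X Y : {set gT}) :
    J1 \subset 'N(N) -> J2 \subset 'N(N) ->
    X \subset N <*> J1 -> Y \subset N <*> J2 ->
  [~: X, Y] \subset N <*> [~: J1, J2].
Proof.
move=> n1 n2 s1 s2.
have nX : X \subset 'N(N) by rewrite (subset_trans s1) // join_subG normG.
have nY : Y \subset 'N(N) by rewrite (subset_trans s2) // join_subG normG.
have nXY (U V : {set gT}) : U \subset 'N(N) -> V \subset 'N(N) ->
  [~: U, V] \subset 'N(N).
  by move=> nU nV; rewrite (subset_trans (commgSS nU nV)) // commg_subr normG.
rewrite norm_joinEr ?nXY // -quotientSK ?nXY // !quotientR // commgSS //.
  by rewrite quotientSK // -norm_joinEr.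
by rewrite quotientSK // -norm_joinEr.
Qed.

Lemma der_joing N C X m : C \subset 'N(N) -> X \subset N <*> C ->
  X^`(m) \subset N <*> C^`(m).
Proof.
move=> nC sX; elim: m => [|m IH]; first by rewrite !derg0.
by rewrite !dergSn; apply: commg_joing; rewrite // (subset_trans (der_sub _ _)).
Qed.

Lemma der_leq X m n : m <= n -> X^`(n) \subset X^`(m).
Proof.
by move/subnKC <-; elim: (n - m) => [|k IH];
  rewrite ?addn0 // addnS (subset_trans (der_subS _ _)).
Qed.

(** Some derived subgroup of [P] lies in both [K <*> J1] and [K <*> J2]; the next one then lies in
    [K <*> [~: J1, J2]], which is [K]. *)
Lemma solvable_mod_commuting P K J1 J2 : K <| P -> proper_solvable_mod P K ->
    J1 <| P -> J2 <| P -> ~~ (J1 \subset K) -> ~~ (J2 \subset K) ->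
    [~: J1, J2] \subset K -> solvable_mod K P.
Proof.
move=> nK pq n1 n2 h1 h2 h12.
have [m1 s1] := pq _ n1 h1; have [m2 s2] := pq _ n2 h2.
exists (maxn m1 m2).+1; rewrite dergSn.
suff /subset_trans -> : [~: P^`(maxn m1 m2), P^`(maxn m1 m2)] \subset K <*>
  [~: J1, J2] => //.
  by rewrite join_subG subxx.
apply: commg_joing; rewrite ?(subset_trans (normal_sub _) (normal_norm nK)) //.
  by rewrite (subset_trans _ s1) // der_leq // leq_maxl.
by rewrite (subset_trans _ s2) // der_leq // leq_maxr.
Qed.

(* Commutators of two normal subgroups lie in their intersection, so the
   derived series of C descends into all conjugates of K at once. *)
Lemma solvable_mod_gcore A P K B C : P \subset A -> K <| P -> B <| A ->
    C <| A -> C \subset P -> B \subset C -> solvable_mod (B <*> K) C ->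
  solvable_mod (B <*> gcore K A) C.
Proof.
move=> sPA nK nB nC sCP sBC [n hn].
have nCB: C \subset 'N(B) := subset_trans (normal_sub nC) (normal_norm nB).
have nPC: C <| P by rewrite (normalS sCP sPA).
(* Induction on a list of elements of [A]: conjugates of [K] are intersected one at a time, and the
   list of all of [A] yields the core. *)
suff /(_ (enum A)) [|J [nJ sJ [m hm]]]: forall s : seq gT, {subset s <= A} ->
    exists J : {group gT}, [/\ J <| C, forall a, a \in s -> J \subset K :^ a &
      solvable_mod (B <*> J) C].
- by move=> a; rewrite mem_enum.
- exists m; apply: (subset_trans hm); rewrite genS // setUS //.
  by apply/bigcapsP => a Aa; apply: sJ; rewrite mem_enum.
elim=> [|a s IH] sA; first by exists C; split=> //; exists 0;
  rewrite derg0 joing_subr.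
have [|J [nJ sJ [m hm]]] := IH; first by move=> b bs; rewrite sA // inE bs orbT.
have Aa: a \in A by rewrite sA // mem_head.
have eC: C :^ a = C by rewrite (normsP (normal_norm nC)).
have eB: B :^ a = B by rewrite (normsP (normal_norm nB)).
have nCK: (C :&: K :^ a)%G <| C.
  have : (C :&: K) :^ a <| C :^ a by rewrite normalJ (normalGI sCP).
  by rewrite conjIg eC.
(* Conjugation by [a] preserves [B] and the derived subgroups of [C], so [hn] also holds with
   [K :^ a]; the modular law cuts [K :^ a] down to [C]. *)
have hna: C^`(n) \subset B <*> (C :&: K :^ a)%G.
  rewrite /= norm_joinEr ?(subset_trans (normal_sub nCK)) //= setIC group_modl
    // subsetI der_sub andbT.
  have nKB: K :^ a \subset 'N(B).
    rewrite -eB normJ conjSg (subset_trans (normal_sub nK)) //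
      (subset_trans sPA) //.
    exact: normal_norm.
  rewrite -norm_joinEr // -eB -conjYg -(normsP (char_norm_trans (der_char n C)
    (normal_norm nC)) a Aa).
  by rewrite conjSg.
exists (J :&: (C :&: K :^ a))%G; split.
- exact: normalI.
- move=> b; rewrite inE => /predU1P[-> | bs]; first by rewrite /= setIA
    subsetIr.
  by rewrite subIset // sJ.
exists (maxn m n).+1; rewrite dergSn.
suff /subset_trans -> : [~: C^`(maxn m n), C^`(maxn m n)] \subset B <*>
  [~: J, (C :&: K :^ a)%G] => //.
  rewrite genS // setUS // commg_subI // subsetI subxx /=.
    by rewrite (subset_trans (normal_sub nJ) (normal_norm nCK)).
  by rewrite (subset_trans (normal_sub nCK) (normal_norm nJ)).
apply: commg_joing; rewrite ?(subset_trans (normal_sub _) nCB) //.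
  by rewrite (subset_trans _ hm) // der_leq // leq_maxl.
by rewrite (subset_trans _ hna) // der_leq // leq_maxr.
Qed.

(** * Normal cores along one step of the chain, modulo [N] *)

Section Cores.
Variables A N : {group gT}.
Hypotheses (nNA : N <| A) (pqA : proper_solvable_mod A N).
Hypothesis nsA : ~ solvable_mod N A.

(** [K] is the kernel of [P] acting on the cosets of [Q]. A failure gives a normal subgroup [M] of
    [A] inside [P] but not inside [N], commuting with [P :&: N] modulo [K]. Either one of the two
    lies in [K], which puts [M] in [Q] and so in [N], or [P] is solvable modulo [K], which [insol]
    excludes. *)
Lemma gcore_joing_sub P Q : Q \subset P -> P \subset A ->
    proper_solvable_mod P (gcore Q P) -> ~~ (gcore P A \subset N) ->
    gcore Q A \subset N ->
  gcore (N <*> Q) A \subset N.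
Proof.
move=> sQP sPA; set K := gcore_group Q P => pqP hC hQ.
have sQA := subset_trans sQP sPA.
have sKQ : K \subset Q by apply: gcore_sub.
have nK : K <| P by apply: gcore_normal.
set C := gcore_group P A in hC.
have nC : C <| A by apply: gcore_normal.
have sCP : C \subset P by apply: gcore_sub.
have nNC : C \subset 'N(N) := subset_trans (normal_sub nC) (normal_norm nNA).
(* Otherwise [C] would be solvable modulo [B <*> gcore K A], which lies in [N]; as [A] is solvable
   modulo [N <*> C], it would be solvable modulo [N]. *)
have insol B : B <| A -> B \subset C -> B \subset N ->
  ~ solvable_mod (B <*> K) C.
  move=> nB sBC sBN h; have [m hm] := solvable_mod_gcore sPA nK nB nC sCP sBC h.
  have [l hl] := pqA nC hC; apply: nsA; exists (l + m)%N.
  have -> : A^`(l + m) = (A^`(l))^`(m).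
    by elim: m {hm} => [|m IH]; rewrite ?addn0 // addnS dergSn IH.
  rewrite (subset_trans (der_joing m nNC hl)) // join_subG subxx
    (subset_trans hm) //.
  rewrite join_subG sBN (subset_trans _ hQ) //.
  by apply/bigcapsP=> a Aa; rewrite (subset_trans (bigcap_inf a Aa)) // conjSg.
have subN M : M <| A -> M \subset Q -> M \subset N.
  by move=> nM sM; apply: subset_trans hQ; rewrite gcore_max // normal_norm.
apply/negPn/negP=> hR; set R := gcore_group (N <*> Q) A in hR.
have nR : R <| A by rewrite gcore_normal // join_subG (normal_sub nNA).
pose M := (C :&: R)%G; have nM : M <| A by apply: normalI.
have sMP : M \subset P by rewrite subIset // sCP.
(* If [C :&: R] were inside [N], then [C] and [R] would commute modulo [N]. *)
have hM : ~~ (M \subset N).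
  apply/negP=> sM; apply: nsA; apply: (solvable_mod_commuting nNA pqA nC nR hC
    hR).
  apply: subset_trans sM; apply: commg_subI; rewrite subsetI subxx.
    by rewrite (subset_trans (normal_sub nC)) // normal_norm.
  by rewrite (subset_trans (normal_sub nR)) // normal_norm.
have sCNK : C :&: N \subset K.
  apply/negPn/negP=> h.
  have nB : (C :&: N)%G <| A by apply: normalI.
  have sBP : (C :&: N)%G \subset P by rewrite subIset // sCP.
  have [n hn] := pqP _ (normalS sBP sPA nB) h.
  apply: (insol _ nB (subsetIl _ _) (subsetIr _ _)); exists n.
  by rewrite joingC (subset_trans (dergS n sCP)).
have sMNQ : M \subset N <*> Q by rewrite subIset // gcore_sub orbT.
have [sPN | hPN] := boolP (P :&: N \subset K).
  case/negP: hM; apply: subN => //.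
  (* By the modular law this intersection is [(P :&: N) * Q], here equal to [Q]. *)
  have : M \subset P :&: N <*> Q by rewrite subsetI sMP.
  rewrite norm_joinEr ?(subset_trans sQA (normal_norm nNA)) // -group_modr
    // => /subset_trans-> //.
  by rewrite mul_subG // (subset_trans sPN).
have [sMK | hMK] := boolP (M \subset K).
  by case/negP: hM; apply: subN => //; apply: subset_trans sKQ.
have nMP : M <| P by rewrite (normalS sMP sPA).
have nPN : (P :&: N)%G <| P by rewrite (normalGI sPA).
have [|n hn] := solvable_mod_commuting nK pqP nMP nPN hMK hPN.
  apply: subset_trans sCNK; apply: (@subset_trans _ _ (mem (M :&: (P :&: N)))).
    rewrite commg_subI // subsetI subxx ?(subset_trans _ (normal_norm nMP))
      ?subsetIl //.
    by rewrite (subset_trans sMP) // normal_norm.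
  by rewrite setIA setSI // -setIA subsetIl.
apply: (insol 1%G); rewrite ?normal1 ?sub1G //; exists n.
by rewrite joing1G (subset_trans (dergS n sCP)).
Qed.

(** By maximality [P :&: (N <*> Q)] is [Q] or [P]. If it were [Q], a derived subgroup of [A] inside
    [N <*> Q] would put one of [P] inside [Q], hence inside [gcore Q P]. *)
Lemma joing_eq_of_gcore P Q : Q \subset P -> P \subset A ->
    (forall B, Q \subset B -> B \subset P -> B :=: Q \/ B :=: P) ->
    ~ solvable_mod (gcore Q P) P -> N <*> P = A ->
    ~~ (gcore (N <*> Q) A \subset N) -> N <*> Q = A.
Proof.
move=> sQP sPA maxQ nsP eA hR.
have sQA := subset_trans sQP sPA.
have nNQ : Q \subset 'N(N) := subset_trans sQA (normal_norm nNA).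
set R := gcore_group (N <*> Q) A in hR.
have nR : R <| A by rewrite gcore_normal // join_subG (normal_sub nNA).
have e : P :&: (N <*> Q) = (P :&: N) * Q by rewrite norm_joinEr // -group_modr.
have [||eQ|eP] := maxQ (P :&: (N <*> Q))%G.
- by rewrite subsetI sQP joing_subr.
- exact: subsetIl.
- case: nsP; have [n hn] := pqA nR hR; exists n.
  apply: gcore_max (der_norm _ _); rewrite -eQ /= subsetI der_sub.
  rewrite (subset_trans (dergS n sPA)) // (subset_trans hn) // join_subG
    joing_subl.
  exact: gcore_sub.
apply/eqP; rewrite eqEsubset join_subG (normal_sub nNA) sQA /= -{1}eA join_subG
  joing_subl.
by rewrite -eP subsetIr.
Qed.

(** By the modular law [B] equals [N <*> (P :&: B)], and maximality applies to [P :&: B]. *)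
Lemma joing_maximal P Q : Q \subset P -> P \subset A ->
    (forall B, Q \subset B -> B \subset P -> B :=: Q \/ B :=: P) ->
  forall B, N <*> Q \subset B -> B \subset N <*> P ->
    B :=: N <*> Q \/ B :=: N <*> P.
Proof.
move=> sQP sPA maxQ B; rewrite join_subG => /andP[sNB sQB] sBP.
have nNP : P \subset 'N(N) := subset_trans sPA (normal_norm nNA).
have eB : B :=: N <*> (P :&: B).
  rewrite norm_joinEr ?subIset ?nNP // group_modl // -norm_joinEr //.
  by apply/esym/setIidPr.
have [|| e | e] := maxQ (P :&: B)%G; rewrite ?subsetI ?sQP ?subsetIl //.
  by left; rewrite {1}eB e.
by right; rewrite {1}eB e.
Qed.

End Cores.
End GroupLemmas.

(** A nontrivial normal [J] contains a minimal normal subgroup, which can only be [M]; so [G / J] is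
    a quotient of [G / M]. *)
Lemma solvable_quo_unique_minnormal (gT : finGroupType) (G : {group gT}) :
    unique_minnormal_solvable_quotient G ->
  forall J : {group gT}, J <| G -> J :!=: 1 -> solvable (G / J).
Proof.
case=> M [minM uniqM solM] J nJ ntJ.
have [M' minM' sM'J] : {M' : {group gT} | minimal_normal M' G & M' \subset J}.
  by apply: mingroup_exists; rewrite ntJ.
have nM : M <| G by case/mingroupP: minM => /andP[].
have [n hn] := (solvable_quo_der nM).1 solM.
apply/(solvable_quo_der nJ); exists n.
by rewrite (subset_trans hn) // -(uniqM _ minM').
Qed.

Lemma proper_solvable_mod_isog (gT rT : finGroupType) (G : {group gT})
    (P K : {group rT}) :
    K <| P -> G \isog P / K ->
    (forall J : {group gT}, J <| G -> J :!=: 1 -> solvable (G / J)) ->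
  proper_solvable_mod P K.
Proof.
move=> nK; rewrite isog_sym => /isogP[f injf imf] solG J nJ hJ.
have nKJ : J \subset 'N(K) := subset_trans (normal_sub nJ) (normal_norm nK).
have sJP : J / K \subset P / K by rewrite quotientS ?normal_sub.
have ntJ : f @* (J / K) != 1.
  rewrite morphim_injm_eq1 // -subG1 quotient_sub1 //.
have nJG : f @* (J / K) <| G by rewrite -imf morphim_normal // quotient_normal.
have [n] := (solvable_quo_der nJG).1 (solG _ nJG ntJ).
rewrite -imf -morphim_der // injmSK ?der_sub // -quotient_der ?normal_norm
  // => hn.
exists n; rewrite norm_joinEr // -quotientSK //.
by rewrite (subset_trans (der_sub _ _)) ?normal_norm.
Qed.

Lemma solvable_mod_isog (gT rT : finGroupType) (G : {group gT})
    (P K : {group rT}) :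
  K <| P -> G \isog P / K -> solvable_mod K P <-> solvable G.
Proof.
by move=> nK isoG; rewrite (isog_sol isoG); apply: iff_sym;
  apply: solvable_quo_der.
Qed.

(** * Embeddings of field extensions *)

Section FieldLemmas.
Local Open Scope ring_scope.

Lemma ahom_eqP (F : fieldType) (Z L : fieldExtType F) (e1 e2 : 'AHom(Z, L)) :
  e1 =1 e2 -> e1 = e2.
Proof. by move=> h; apply/val_inj/lfunP. Qed.

Lemma ahom_inj (F : fieldType) (Z L : fieldExtType F) (e : 'AHom(Z, L)) :
  injective e.
Proof. exact: fmorph_inj. Qed.

(** This turns inclusions of subfields of [L] into morphisms of curves. *)
Lemma ahom_factor (F : fieldType) (Z1 Z2 L : fieldExtType F)
    (e1 : 'AHom(Z1, L)) (e2 : 'AHom(Z2, L)) :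
  (e1 @: {:Z1} <= e2 @: {:Z2})%VS -> {u : 'AHom(Z1, Z2) | e1 = (e2 \o u)%AF}.
Proof.
move=> s12; pose u := (e2^-1 \o e1)%VF.
have uK z : e2 (u z) = e1 z.
  by rewrite comp_lfunE limg_lfunVK // (subvP s12) // memv_img ?memvf.
have uP : ahom_in {:Z1} u.
  apply/ahom_inP; split=> [x y _ _|]; apply: (@ahom_inj _ _ _ e2).
    by rewrite rmorphM /= !uK rmorphM.
  by rewrite /= uK !rmorph1.
by exists (AHom uP); apply: ahom_eqP => z; rewrite /= comp_lfunE uK.
Qed.

(** * Independence of the ambient splitting field *)

Section Transfer.
Variables (F : fieldType) (N : fieldExtType F).

Section OneEmbedding.
Variables (L : splittingFieldType F) (j : 'AHom(N, L)).
Local Notation E := (j @: {:N})%AS.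

(** Together with [gal_of_AEnd], this matches automorphisms of the image of [N] with endomorphisms
    of [N], a description free of [L]. *)
Lemma AEnd_of_gal (x : gal_of E) :
  {a : 'AEnd(N) | forall n, x (j n) = j (a n)}.
Proof.
have [|a ea] := @ahom_factor _ _ _ _ (gal_repr x \o j)%AF j.
  by rewrite limg_comp; have /= -> := limg_gal x.
exists a => n; have := congr1 (fun e : 'AHom(N, L) => e n) ea.
by rewrite !comp_lfunE.
Qed.

Lemma gal_of_AEnd (a : 'AEnd(N)) :
  {x : gal_of E | forall n, x (j n) = j (a n)}.
Proof.
pose f : 'End(L) := (j \o (a \o j^-1))%VF.
have fj n : f (j n) = j (a n).
  by rewrite !comp_lfunE lker0_lfunK // AHom_lker0.
have : kAut 1 E f.
  rewrite kAutE k1HomE; apply/andP; split.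
    apply/ahom_inP; split=> [_ _ /memv_imgP[u _ ->] /memv_imgP[v _ ->]|].
      by rewrite -rmorphM !fj !rmorphM.
    by rewrite -(rmorph1 j) fj !rmorph1.
  by apply/subvP=> _ /memv_imgP[_ /memv_imgP[n _ ->] ->];
    rewrite fj memv_img ?memvf.
case/kAut_to_gal=> x _ xf; exists x => n.
by rewrite -xf ?fj // memv_img ?memvf.
Qed.

Lemma mem_gal_aimg (M : {subfield N}) (x : gal_of E) (a : 'AEnd(N)) :
  (forall n, x (j n) = j (a n)) ->
  reflect {in M, forall n, a n = n} (x \in 'Gal(E / (j @: M)%AS)).
Proof.
move=> xa; rewrite gal_kHom ?limgS ?subvf //.
apply: (iffP kAHomP) => h n.
  by move=> Mn; apply: (@ahom_inj _ _ _ j); rewrite /= -xa h // memv_img.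
by case/memv_imgP=> m Mm ->; rewrite xa h.
Qed.

Lemma gal_aimg_inj (x y : gal_of E) (a : 'AEnd(N)) :
  (forall n, x (j n) = j (a n)) -> (forall n, y (j n) = j (a n)) -> x = y.
Proof.
by move=> hx hy; apply/eqP/gal_eqP => _ /memv_imgP[n _ ->]; rewrite hx hy.
Qed.

End OneEmbedding.

Variables (L1 L2 : splittingFieldType F) (j1 : 'AHom(N, L1))
    (j2 : 'AHom(N, L2)).
Variable M : {subfield N}.

Definition transfer (x : gal_of (j1 @: {:N})%AS) : gal_of (j2 @: {:N})%AS :=
  sval (gal_of_AEnd j2 (sval (AEnd_of_gal x))).

Lemma transferE x n : transfer x (j2 n) = j2 (sval (AEnd_of_gal x) n).
Proof. by rewrite /transfer; case: gal_of_AEnd. Qed.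

Lemma transferM : {morph transfer : x y / (x * y)%g}.
Proof.
move=> x y; apply/eqP/gal_eqP => _ /memv_imgP[n _ ->].
have [E1 E2]: j2 n \in (j2 @: {:N})%VS /\ j1 n \in (j1 @: {:N})%VS.
  by rewrite !memv_img ?memvf.
rewrite galM // !transferE; congr (j2 _); apply: (@ahom_inj _ _ _ j1).
rewrite -(svalP (AEnd_of_gal (x * y)%g)) galM //.
by rewrite (svalP (AEnd_of_gal x)) (svalP (AEnd_of_gal y)).
Qed.

Canonical transfer_morphism :=
  @Morphism _ _ 'Gal((j1 @: {:N})%AS / (j1 @: M)%AS) transfer (in2W transferM).

Lemma transfer_inj : injective transfer.
Proof.
move=> x y exy; apply: gal_aimg_inj (svalP (AEnd_of_gal x)) _ => n.
rewrite (svalP (AEnd_of_gal y)); congr (j1 _); apply: (@ahom_inj _ _ _ j2).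
by rewrite -!transferE exy.
Qed.

Lemma transfer_mem x :
  (transfer x \in 'Gal((j2 @: {:N})%AS / (j2 @: M)%AS)) =
  (x \in 'Gal((j1 @: {:N})%AS / (j1 @: M)%AS)).
Proof.
apply/(mem_gal_aimg _ (transferE x))/(mem_gal_aimg _
  (svalP (AEnd_of_gal x))) => //.
Qed.

Lemma gal_transfer_isog :
  'Gal((j1 @: {:N})%AS / (j1 @: M)%AS) \isog
  'Gal((j2 @: {:N})%AS / (j2 @: M)%AS).
Proof.
apply/isogP; exists transfer_morphism; first by apply/injmP=> x y _ _
  /transfer_inj.
apply/setP=> y; apply/morphimP/idP => [[x _ Gx ->] | Gy];
  first by rewrite transfer_mem.
have [a ya] := AEnd_of_gal y; have [x xa] := gal_of_AEnd j1 a.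
have exy : y = transfer x.
  apply: gal_aimg_inj ya _ => n; rewrite transferE; congr (j2 _).
  by apply: (@ahom_inj _ _ _ j1); rewrite -(svalP (AEnd_of_gal x)) xa.
have Gx : x \in 'Gal((j1 @: {:N})%AS / (j1 @: M)%AS) by rewrite -transfer_mem
  -exy.
by exists x.
Qed.

(** Being Galois means that the fixed field is no larger than the image of [M], and fixed elements
    can be compared inside [N]. *)
Lemma galois_transfer :
  galois (j1 @: M)%AS (j1 @: {:N})%AS -> galois (j2 @: M)%AS (j2 @: {:N})%AS.
Proof.
move/galois_fixedField=> fix1; apply/galois_fixedField/eqP.
rewrite eqEsubv galois_connection_subv ?limgS ?subvf // andbT.
apply/subvP=> v fv; have [/memv_imgP[n _ vn] fixv] := mem_fixedFieldP fv.
rewrite vn in fixv *; have /memv_imgP[m Mm /ahom_inj->] : j1 n \in (j1 @: M)%VS.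
  rewrite -fix1; apply/fixedFieldP; first by rewrite memv_img ?memvf.
  move=> x Gx; rewrite (svalP (AEnd_of_gal x)); congr (j1 _).
  by apply: (@ahom_inj _ _ _ j2); rewrite -transferE fixv // transfer_mem.
exact: memv_img.
Qed.

End Transfer.

Lemma ahom_of_fun (F : fieldType) (Z N : fieldExtType F) (f : Z -> N) :
  linear f -> monoid_morphism f -> {e : 'AHom(Z, N) | e =1 f}.
Proof.
move=> linf monf.
pose fL := GRing.isLinear.Build F Z N *:%R f linf.
pose fM := GRing.isMonoidMorphism.Build Z N f monf.
pose g : {lrmorphism Z -> N} := HB.pack f fL fM.
by exists (linfun_ahom g) => z; exact: (lfunE g z).
Qed.

Section Inclusion.
Variables (F : fieldType) (L : fieldExtType F) (K : {subfield L}).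

Lemma subvs_ahom_subproof : {e : 'AHom(subvs_of K, L) | e =1 vsval}.
Proof.
by apply: ahom_of_fun; [apply: linearP | split;
  [apply: rmorph1 | apply: rmorphM]].
Qed.

Definition subvs_ahom : 'AHom(subvs_of K, L) := sval subvs_ahom_subproof.

Lemma subvs_ahomE : subvs_ahom =1 vsval.
Proof. exact: svalP subvs_ahom_subproof. Qed.

Lemma subvs_ahom_img : (subvs_ahom @: {:subvs_of K})%AS = K.
Proof.
apply/val_inj/vspaceP => x; apply/memv_imgP/idP => [[w _ ->] | Kx].
  by rewrite subvs_ahomE subvsP.
by exists (vsproj K x); rewrite ?memvf // subvs_ahomE vsprojK.
Qed.

End Inclusion.

Lemma in_alg_ahom (F : fieldType) (Z : fieldExtType F) :
  {e : 'AHom(F^o, Z) | e =1 in_alg Z}.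
Proof.
apply: ahom_of_fun; last by split; [apply: rmorph1 | apply: rmorphM].
by move=> a u v; rewrite /= scalerDl scalerA.
Qed.

(** * Embedding a field generated by roots of split polynomials *)

Section Extension.
Variables (F : fieldType) (L N : fieldExtType F).

Lemma subfield_ahom_leq (K M : {subfield L}) : (K <= M)%VS ->
  inhabited 'AHom(subvs_of M, N) -> inhabited 'AHom(subvs_of K, N).
Proof.
move=> sKM [e]; have [|u _] := @ahom_factor _ _ _ _ (subvs_ahom K)
  (subvs_ahom M).
  by have /(congr1 val) /= -> := subvs_ahom_img K; have /(congr1 val) /= -> :=
    subvs_ahom_img M.
by constructor; exact: (e \o u)%AF.
Qed.

Lemma ahom_adjoin_root (M : {subfield L}) (y : L) (m : {poly F}) (r : seq N) :
    root (map_poly (in_alg L) m) y ->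
    map_poly (in_alg N) m = \prod_(z <- r) ('X - z%:P) ->
  'AHom(subvs_of M, N) -> inhabited 'AHom(subvs_of <<M; y>>%AS, N).
Proof.
move=> my mr s.
pose mv := @map_poly (subvs_of M) L vsval.
have [p0 Dp0] := polyOver_subvs (minPolyOver M y).
have dvd0 p : root (mv p) y -> p0 %| p.
  move=> py; rewrite -(dvdp_map (@vsval _ _ M)) -Dp0.
  by apply: minPoly_dvdp => //; apply/polyOver_subvs; exists p.
(* The minimal polynomial of [y] over [M] divides [m]; carried to [N] by [s], it is a nonconstant
   divisor of a product of linear factors. *)
have [z z0]: exists z, root (map_poly s p0) z.
  have : map_poly s p0 %| map_poly (in_alg N) m.
    have -> : map_poly (in_alg N) m = map_poly s
      (map_poly (in_alg (subvs_of M)) m).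
      rewrite -map_poly_comp; apply: eq_map_poly => a.
      by rewrite /= linearZ /= rmorph1.
    rewrite dvdp_map dvd0 // /mv -map_poly_comp /=.
    rewrite (_ : map_poly _ m = map_poly (in_alg L) m) //.
    by apply: eq_map_poly => a /=; rewrite algid1.
  rewrite mr => /dvdp_prod_XsubC[b eb].
  have := eqp_size eb; rewrite size_map_poly -(size_map_poly (@vsval _ _ M))
    -Dp0 size_minPoly.
  case: (mask b r) eb => [|z s'] eb; first by rewrite big_nil size_poly1.
  by exists z; rewrite (eqp_root eb) root_prod_XsubC mem_head.
pose q (w : subvs_of <<M; y>>%AS) := map_poly (vsproj M) (Fadjoin_poly M y
  (vsval w)).
pose f w := (map_poly s (q w)).[z].
(* Evaluation at y and at z: the kernel of the former is generated by p0, hence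
   contained in the kernel of the latter, so f does not depend on q. *)
have qE w : (mv (q w)).[y] = vsval w.
  rewrite -[RHS](@Fadjoin_poly_eq _ _ M y) ?subvsP //; congr _.[y].
  apply/polyP=> i; rewrite !coef_map /= vsprojK //.
  exact: (polyOverP (Fadjoin_polyOver _ _ _)).
have fE p w : (mv p).[y] = vsval w -> f w = (map_poly s p).[z].
  move=> pw; apply/eqP; rewrite -subr_eq0 /f -hornerN -hornerD -!rmorphN
    -!rmorphD -/(root _ _).
  have : p0 %| (q w - p) by apply: dvd0; rewrite /root /mv rmorphB hornerD
    hornerN qE -pw subrr.
  by rewrite -(dvdp_map s) -dvdp_XsubCl; apply: dvdp_trans; rewrite dvdp_XsubCl.
have [e _] : {e : 'AHom(subvs_of <<M; y>>%AS, N) | e =1 f}.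
  apply: ahom_of_fun; last split.
  - move=> a u v; rewrite (fE (a%:A *: q u + q v)).
      by rewrite rmorphD /= map_polyZ hornerD hornerZ /= linearZ /= rmorph1
        -scalerAl mul1r.
    rewrite /mv rmorphD /= map_polyZ hornerD hornerZ !qE /=.
    rewrite -scalerAl -[in RHS](mul1r (vsval u)); congr (_ *: (_ * _) + _).
    exact: algid1.
  - rewrite (fE 1); first by rewrite rmorph1 hornerC.
    by rewrite /mv rmorph1 hornerC; apply/esym; exact: algid1.
  move=> u v; rewrite (fE (q u * q v)); first by rewrite rmorphM hornerM.
  by rewrite /mv rmorphM hornerM !qE.
by constructor.
Qed.

(** The roots are adjoined one at a time, starting from the base field; each step passes on the
    existence of an embedding. *)
Lemma ahom_adjoin_roots (s : seq L) :
    (forall y, y \in s -> exists (m : {poly F}) (r : seq N),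
      root (map_poly (in_alg L) m) y /\
      map_poly (in_alg N) m = \prod_(z <- r) ('X - z%:P)) ->
  forall K : {subfield L}, (K <= <<1 & s>>)%VS ->
    inhabited 'AHom(subvs_of K, N).
Proof.
move=> hs K; have: inhabited 'AHom(subvs_of (1%AS : {subfield L}), N).
  have [a ha] := in_alg_ahom L; have [b _] := in_alg_ahom N.
  have [|u _] := @ahom_factor _ _ _ _ (subvs_ahom (1%AS : {subfield L})) a.
    have /(congr1 val) /= -> := subvs_ahom_img (1%AS : {subfield L}).
    by rewrite sub1v.
  by constructor; exact: (b \o u)%AF.
suff: forall M : {subfield L}, inhabited 'AHom(subvs_of M, N) ->
    (K <= <<M & s>>)%VS -> inhabited 'AHom(subvs_of K, N) by apply.
elim: s hs => [|y s IH] hs M hM.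
  by rewrite Fadjoin_nil => sKM; apply: subfield_ahom_leq hM.
have [|m [r [my mr]]] := hs y; first exact: mem_head.
have [e] := hM; have {}hM := ahom_adjoin_root my mr e.
rewrite adjoin_cons; apply: (IH _ <<M; y>>%AS) hM => u us.
by apply: hs; rewrite inE us orbT.
Qed.

End Extension.

Lemma root_ahom (F : fieldType) (Z N : fieldExtType F) (e : 'AHom(Z, N))
    (m : {poly F}) b :
  root (map_poly (in_alg N) m) (e b) = root (map_poly (in_alg Z) m) b.
Proof.
rewrite -(fmorph_root e) -map_poly_comp; congr root; apply: eq_map_poly => a.
by rewrite /= linearZ /= rmorph1.
Qed.

Lemma aimg_comp (F : fieldType) (Z N L : fieldExtType F) (e : 'AHom(N, L))
    (c : 'AHom(Z, N)) (K : {subfield Z}) :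
  ((e \o c)%AF @: K)%AS = (e @: (c @: K))%AS.
Proof. by apply/val_inj; rewrite /= limg_comp. Qed.

Lemma dim_aimg (F : fieldType) (Z N : fieldExtType F) (e : 'AHom(Z, N))
    (K : {vspace Z}) :
  \dim (e @: K) = \dim K.
Proof. by rewrite limg_dim_eq // (eqP (AHom_lker0 e)) capv0. Qed.

Lemma aimg_one (F : fieldType) (Z N : fieldExtType F) (e : 'AHom(Z, N)) :
  (e @: 1%AS)%AS = 1%AS.
Proof. by apply/val_inj; rewrite /= aimg1. Qed.

End FieldLemmas.

(** * Coverings and subgroups of the Galois group *)

Section Coverings.
Local Open Scope ring_scope.

Section P1.
Variable k : fieldType.

(** The function field of [P1 k] is the base field, over which embeddings are linear. Hence every
    triangle of coverings over the line commutes. *)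
Lemma cov_P1_unique (Z : curve k) (c c' : covering Z (P1 k)) : c = c'.
Proof.
apply: ahom_eqP => a; have -> : a = a *: (1 : P1 k) by rewrite /GRing.scale /=
  mulr1.
by rewrite !linearZ /= !rmorph1.
Qed.

Lemma cov_field_P1 (Z : curve k) (c : covering Z (P1 k)) : cov_field c = 1%AS.
Proof. by apply/val_inj; rewrite /= regular_fullv aimg1. Qed.

Definition cov_P1 (Z : curve k) : covering Z (P1 k) := sval (in_alg_ahom Z).

Lemma subcover_P1 (Y X : curve k) (h : covering Y (P1 k))
    (g : covering X (P1 k)) :
  covering X Y -> subcover h g.
Proof. by move=> c; exists c; apply: cov_P1_unique. Qed.
End P1.

Lemma cov_compA (k : fieldType) (Z V U W : curve k)
    (c1 : covering U W) (c2 : covering V U) (c3 : covering Z V) :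
  cov_comp c1 (cov_comp c2 c3) = cov_comp (cov_comp c1 c2) c3.
Proof. by apply: ahom_eqP => z; rewrite /= !comp_lfunE. Qed.

Lemma degree1P (k : fieldType) (Z W : curve k) (c : covering Z W) :
  degree c = 1%N <-> cov_field c = {:Z}%AS.
Proof.
have e : \dim {:Z} = (degree c * \dim (cov_field c))%N
  by apply/dim_sup_field/subvf.
split=> [d1 | ec]; last by rewrite /degree ec divnn adim_gt0.
by apply/val_inj/eqP; rewrite eqEdim subvf /= e d1 mul1n.
Qed.

(** * Intermediate curves of a Galois covering of the line as subgroups *)

Section Ambient.
Variables (k : fieldType) (L : splittingFieldType (ratfun k)).
Variables (Xt : curve k) (j : 'AHom(Xt, L)).
Local Notation Om := (j @: {:Xt})%AS.
Hypothesis galOm : galois 1%AS Om.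

Definition subfield_of (Z : curve k) (u : covering Xt Z) : {subfield L} :=
  ((j \o u)%AF @: {:Z})%AS.

Definition subgroup_of (Z : curve k) (u : covering Xt Z) :=
    'Gal(Om / subfield_of u)%G.

Lemma subfield_of_le (Z : curve k) (u : covering Xt Z) :
  (subfield_of u <= Om)%VS.
Proof. by rewrite /subfield_of aimg_comp limgS ?subvf. Qed.

Lemma galois_subfield (K : {subfield L}) : (K <= Om)%VS -> galois K Om.
Proof. by move=> sK; apply: galoisS galOm; rewrite sub1v. Qed.

Lemma fixedField_subgroup_of (Z : curve k) (u : covering Xt Z) :
  fixedField (subgroup_of u) = subfield_of u.
Proof. by apply/galois_fixedField/galois_subfield/subfield_of_le. Qed.

Lemma subfield_of_comp (Z W : curve k) (c : covering Z W) (u : covering Xt Z) :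
  subfield_of (cov_comp c u) = ((j \o u)%AF @: cov_field c)%AS.
Proof. by rewrite /subfield_of -aimg_comp; congr (_ @: _)%AS;
  apply: ahom_eqP => z; rewrite /= !comp_lfunE. Qed.

Lemma subfield_of_comp_le (Z W : curve k) (c : covering Z W)
    (u : covering Xt Z) :
  (subfield_of (cov_comp c u) <= subfield_of u)%VS.
Proof. by rewrite subfield_of_comp limgS ?subvf. Qed.

Lemma subgroup_of_comp_sub (Z W : curve k) (c : covering Z W)
    (u : covering Xt Z) :
  subgroup_of u \subset subgroup_of (cov_comp c u).
Proof. exact/galS/subfield_of_comp_le. Qed.

Lemma subfield_of_P1 (w : covering Xt (P1 k)) : subfield_of w = 1%AS.
Proof. by apply/val_inj; rewrite /= regular_fullv aimg1. Qed.

Lemma subgroup_of_P1 (w : covering Xt (P1 k)) :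
  subgroup_of w = 'Gal(Om / 1%AS)%G.
Proof. by rewrite /subgroup_of subfield_of_P1. Qed.

Lemma cov_of_subfield (K : {subfield L}) : (K <= Om)%VS ->
  {u : covering Xt (subvs_of K) | subfield_of u = K}.
Proof.
move=> sK; have [|u eu] := @ahom_factor _ _ _ _ (subvs_ahom K) j.
  by have /(congr1 val) /= -> := subvs_ahom_img K.
by exists u; rewrite /subfield_of -eu subvs_ahom_img.
Qed.

Lemma cov_factor (Z W : curve k) (u : covering Xt Z) (w : covering Xt W) :
  (subfield_of w <= subfield_of u)%VS -> {c : covering Z W | w = cov_comp c u}.
Proof.
case/ahom_factor=> c ec; exists c; apply: ahom_eqP => z.
apply: (@ahom_inj _ _ _ j); have := congr1 (fun e : 'AHom(W, L) => e z) ec.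
by rewrite /= !comp_lfunE.
Qed.

Lemma cov_comp_inj (Z W : curve k) (u : covering Xt Z) (c c' : covering Z W) :
  cov_comp c u = cov_comp c' u -> c = c'.
Proof.
move=> e; apply: ahom_eqP => z; apply: (@ahom_inj _ _ _ u).
by have := congr1 (fun e : covering Xt W => e z) e; rewrite /= !comp_lfunE.
Qed.

(** Galois correspondence: the groups in between are those of the curves between [Z] and [W], and
    degree 1 means equality of groups. *)
Lemma indecomposable_maximal (Z W : curve k) (c : covering Z W)
    (u : covering Xt Z) :
  indecomposable c <->
  forall B : {group gal_of Om}, subgroup_of u \subset B ->
    B \subset subgroup_of (cov_comp c u) ->
    B :=: subgroup_of u \/ B :=: subgroup_of (cov_comp c u).
Proof.
split=> [ic B sB Bs | maxB U c1 c2 ec].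
  have [v ev] := cov_of_subfield (fixedField_bound B).
  have [|c2 e2] := @cov_factor _ _ u v;
    first by rewrite ev -fixedField_subgroup_of fixedFieldS.
  have [|c1 e1] := @cov_factor _ _ v (cov_comp c u).
    by rewrite ev -fixedField_subgroup_of fixedFieldS.
  have eB : B = subgroup_of v by rewrite /subgroup_of ev; apply/val_inj;
    rewrite /= gal_fixedField.
  have /ic[/degree1P d1 | /degree1P d2] : c = cov_comp c1 c2.
  - by apply: (@cov_comp_inj _ _ u); rewrite -cov_compA -e2.
  - by right; rewrite eB /subgroup_of e1 subfield_of_comp d1.
  by left; rewrite eB /subgroup_of e2 subfield_of_comp d2.
have inj_subfield (V1 V2 : curve k) (v1 : covering Xt V1)
    (v2 : covering Xt V2) :
  subgroup_of v1 :=: subgroup_of v2 -> subfield_of v1 = subfield_of v2.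
  by move=> e; apply/val_inj; rewrite /= -!fixedField_subgroup_of e.
have full (V1 V2 : curve k) (v : covering Xt V1) (b : covering V1 V2) :
    subfield_of (cov_comp b v) = subfield_of v -> degree b = 1%N.
  rewrite subfield_of_comp => e; apply/degree1P/val_inj/eqP;
    rewrite eqEdim subvf /=.
  by rewrite -(dim_aimg (j \o v)%AF {:V1}) -(dim_aimg (j \o v)%AF (b @: _))
    -[X in (\dim X <= _)%N](congr1 val e).
have [||eB|eB] := maxB (subgroup_of (cov_comp c2 u)).
- exact: subgroup_of_comp_sub.
- by rewrite ec -cov_compA subgroup_of_comp_sub.
- by right; apply: full (inj_subfield _ _ _ _ eB).
by left; apply: (full _ _ (cov_comp c2 u)); rewrite cov_compA -ec;
  apply/esym/inj_subfield.
Qed.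

(** * Galois closures as fixed fields of normal cores *)

Definition core (Z W : curve k) (u : covering Xt Z) (w : covering Xt W) :
    {group gal_of Om} :=
  gcore_group (subgroup_of u) (subgroup_of w).

(** The compositum of the conjugates of [subfield_of u] under [subgroup_of w]. *)
Definition closure_field (Z W : curve k) (u : covering Xt Z)
    (w : covering Xt W) : {subfield L} :=
  fixedField_aspace (core u w).

Lemma galois_closure_field (Z W : curve k) (u : covering Xt Z)
    (w : covering Xt W) :
  subgroup_of u \subset subgroup_of w ->
  galois (subfield_of w) (closure_field u w).
Proof.
move=> suw; apply: normal_fixedField_galois; last exact: gcore_normal.
exact/(galois_subfield)/subfield_of_le.
Qed.

Lemma subfield_of_closure_le (Z W : curve k) (u : covering Xt Z)
    (w : covering Xt W) :
  (subfield_of u <= closure_field u w)%VS.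
Proof. by rewrite -(fixedField_subgroup_of u) fixedFieldS ?gcore_sub. Qed.

Lemma closure_isog (Z W : curve k) (u : covering Xt Z) (w : covering Xt W) :
  subgroup_of u \subset subgroup_of w ->
  (subgroup_of w / core u w)%g \isog 'Gal(closure_field u w / subfield_of w).
Proof.
move=> suw; have galw := galois_subfield (subfield_of_le w).
have /and3P[sw _ nw] := galois_closure_field suw.
rewrite -(gal_fixedField (core u w)) normalField_isog //.
by rewrite sw fixedField_bound.
Qed.

(** Normality splits the minimal polynomial of [j' a] in the image of [N'], and the roots pull back
    along [j']. *)
Lemma split_root (N' : curve k) (L' : splittingFieldType (ratfun k))
    (j' : 'AHom(N', L')) :
    galois 1%AS (j' @: {:N'})%AS -> forall a : N',
  exists (m : {poly ratfun k}) (r : seq N'),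
    root (map_poly (in_alg N') m) a /\
    map_poly (in_alg N') m = \prod_(z <- r) ('X - z%:P).
Proof.
move=> /and3P[_ _ /normalFieldP nN] a.
have [|r /allP rE er] := nN (j' a); first by rewrite memv_img ?memvf.
have /polyOver1P[m em] := minPolyOver 1%AS (j' a).
exists m, [seq (j'^-1)%VF y | y <- r].
have mj : map_poly j' (map_poly (in_alg N') m) = map_poly (in_alg L') m.
  rewrite -map_poly_comp; apply: eq_map_poly => c.
  by rewrite /= linearZ /= rmorph1.
split; first by rewrite -(root_ahom j') -em root_minPoly.
apply: (map_poly_inj j'); rewrite mj -em er rmorph_prod /= big_map.
apply: eq_big_seq => y yr; rewrite rmorphB /= map_polyX map_polyC /=.
by rewrite limg_lfunVK //; apply: rE.
Qed.

(** The closure field lies in the field generated by the conjugates of a basis of [Z]. Each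
    conjugate is a root of a polynomial over [k(t)] that annihilates an element of [N'], and it
    splits there since [N'] is Galois. *)
Lemma closure_field_ahom (Z : curve k) (u : covering Xt Z)
    (w : covering Xt (P1 k))
    (N' : curve k) (g' : covering N' (P1 k)) :
  galois_cover g' -> covering N' Z ->
  inhabited (covering N' (subvs_of (closure_field u w))).
Proof.
case=> L' [j' gal'] s.
have {}gal' : galois 1%AS (j' @: {:N'})%AS.
  by move: gal'; rewrite /galois_in cov_field_P1 /= aimg1.
pose e := (j \o u)%AF.
pose rs := [seq (x : gal_of Om) (e b) | x <- enum {: gal_of Om}, b <- vbasis
  {:Z}].
apply: (@ahom_adjoin_roots _ _ _ rs) => [y /allpairsP[[x b] [_ _ ->]] /= | ].
  have [m [r [ma mr]]] := split_root gal' (s b); exists m, r; split=> //.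
  have xe : x (e b) = (gal_repr x \o e)%AF b by rewrite [RHS]comp_lfunE.
  by rewrite xe root_ahom -(root_ahom s).
have sT : (<<1 & rs>> <= Om)%VS.
  apply/Fadjoin_seqP; split; first exact: sub1v.
  move=> _ /allpairsP[[x b] [_ _ ->]]; apply: memv_gal.
  by rewrite comp_lfunE memv_img ?memvf.
(* It remains to see that the group fixing [rs] lies in every conjugate of [subgroup_of u], that is,
   fixes every conjugate of [subfield_of u]. *)
have /galois_fixedField <- := galois_subfield (sT : (<<1 & rs>>%AS <= Om)%VS).
apply: fixedFieldS; apply/bigcapsP=> x _; rewrite gal_conjg galS //.
rewrite /subfield_of /= -limg_comp -(span_basis (vbasisP {:Z})) limg_span.
apply/span_subvP=> _ /mapP[b bZ ->]; rewrite comp_lfunE.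
apply: seqv_sub_adjoin; apply/allpairsP; exists (x, b); split=> //=.
exact: mem_enum.
Qed.

Lemma galois_closure_P1 (Z : curve k) (c : covering Z (P1 k))
    (u : covering Xt Z)
    (g : covering (subvs_of (closure_field u (cov_comp c u))) (P1 k)) :
  galois_closure c g.
Proof.
set K := closure_field _ _ in g *.
have suw := subgroup_of_comp_sub c u.
split.
- exists L, (subvs_ahom K); rewrite /galois_in cov_field_P1 subvs_ahom_img /=
    aimg1.
  by have := galois_closure_field suw; rewrite subfield_of_P1.
- have [v ev] := cov_of_subfield (fixedField_bound (core u (cov_comp c u))).
  have [|s _] := @cov_factor _ _ v u;
    first by rewrite ev subfield_of_closure_le.
  exact: subcover_P1 s.
move=> N' g' gal' [s _]; have [t] := closure_field_ahom u (cov_comp c u) gal' s.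
exact: subcover_P1 t.
Qed.

Lemma is_monodromy_P1 (Z : curve k) (c : covering Z (P1 k))
    (u : covering Xt Z) :
  is_monodromy c (subgroup_of (cov_comp c u) / core u (cov_comp c u))%G.
Proof.
set K := closure_field u (cov_comp c u).
exists _, (cov_P1 (subvs_of K)), L, (subvs_ahom K); split;
  first exact: galois_closure_P1.
rewrite cov_field_P1 subvs_ahom_img aimg_one.
by have := closure_isog (subgroup_of_comp_sub c u); rewrite subfield_of_P1.
Qed.

(** The two embeddings of [Z] agree on [W]; passing from one to the other fixes [W] and extends to
    an automorphism because [Om] is normal. *)
Lemma conj_subfield_of (Z W : curve k) (c : covering Z W)
    (u v : covering Xt Z) :
    cov_comp c u = cov_comp c v ->
  exists2 x : gal_of Om, x \in subgroup_of (cov_comp c v) &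
    (x @: subfield_of v)%VS = subfield_of u.
Proof.
move=> ecuv; have galw := galois_subfield (subfield_of_le (cov_comp c v)).
pose f : 'End(L) := ((j \o u)%AF \o ((j \o v)%AF)^-1)%VF.
have fE z : f ((j \o v)%AF z) = (j \o u)%AF z.
  by rewrite [LHS]comp_lfunE lker0_lfunK // AHom_lker0.
have [|||x Gx xf] := @kHom_to_gal _ _ (subfield_of (cov_comp c v))
  (subfield_of v) Om f.
- by rewrite subfield_of_comp_le subfield_of_le.
- by case/and3P: galw.
- apply/kHomP_tmp; split=> [y|].
    case/memv_imgP=> a _ ->.
    have -> : (j \o cov_comp c v)%AF a = (j \o v)%AF (c a).
      by rewrite /= !comp_lfunE.
    rewrite fE; have := congr1 (fun e : covering Xt W => j (e a)) ecuv.
    by rewrite /= !comp_lfunE.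
  move=> _ _ /memv_imgP[y _ ->] /memv_imgP[z _ ->].
  by rewrite -rmorphM !fE rmorphM.
exists x => //; apply/vspaceP=> y; apply/memv_imgP/memv_imgP.
  case=> _ /memv_imgP[z _ ->] ->; exists z; rewrite ?memvf //.
  by rewrite -xf ?fE // memv_img ?memvf.
case=> z _ ->; exists ((j \o v)%AF z); first by rewrite memv_img ?memvf.
by rewrite -xf ?fE // memv_img ?memvf.
Qed.

(** By minimality a Galois closure [N] of [c] embeds in [Xt]. Its image is Galois and contains
    [subfield_of u], hence the closure field; minimality against the curve of the closure field
    bounds its dimension, so the two coincide. *)
Lemma monodromy_isog (Z W : curve k) (c : covering Z W) (u : covering Xt Z)
    (gT : finGroupType) (G : {group gT}) :
  is_monodromy c G ->
  G \isog (subgroup_of (cov_comp c u) / core u (cov_comp c u))%g.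
Proof.
case=> N [g [L' [j' [[[L1 [j1 gal1]] [s ec] ming] isoG]]]].
set w := cov_comp c u; have suw : subgroup_of u \subset subgroup_of w :=
  subgroup_of_comp_sub c u.
have galw := galois_subfield (subfield_of_le w).
have [||v ev] := ming Xt w.
- exists L, j; rewrite /galois_in -aimg_comp.
  exact: galw.
- by exists u.
pose N1 := subfield_of v.
have eK : subfield_of w = ((j \o v)%AF @: cov_field g)%AS by rewrite ev
  subfield_of_comp.
have galN1 : galois (subfield_of w) N1 by rewrite eK;
  apply: galois_transfer gal1.
have sKN1 : (subfield_of w <= N1)%VS by case/and3P: galN1.
have nN1 : ('Gal(Om / N1) <| subgroup_of w)%g.
  by apply: normalField_normal; rewrite ?sKN1 ?subfield_of_le //;
    case/and3P: galN1.
have sEN1 : (subfield_of u <= N1)%VS.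
  (* v is not compatible with u and s: it may carry k(Z) to a conjugate. *)
  have euv : cov_comp c u = cov_comp c (cov_comp s v) by rewrite -/w ev ec
    cov_compA.
  have [x Gx <-] := conj_subfield_of euv; rewrite -euv -/w in Gx.
  apply: (@subv_trans _ _ (x @: N1)%VS); first exact/limgS/subfield_of_comp_le.
  have : kAut (subfield_of w) N1 x.
    apply: (@normalField_kAut _ _ _ N1 Om); rewrite ?sKN1 ?subfield_of_le //.
      by case/and3P: galN1.
    by rewrite -gal_kAut ?subfield_of_le.
  by case/andP=> _ /eqP->.
have sN01 : (closure_field u w <= N1)%VS.
  rewrite -(fixedField_subgroup_of v) fixedFieldS //.
  by apply: gcore_max; [apply: galS | apply: normal_norm].
have eN : closure_field u w = N1.
  apply/val_inj/eqP; rewrite eqEdim sN01 /=.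
  have [v0 ev0] := cov_of_subfield (fixedField_bound (core u w)).
  have [|g0 eg0] := @cov_factor _ _ v0 w.
    by rewrite ev0 (subv_trans (subfield_of_comp_le c u))
      ?subfield_of_closure_le.
  have [|s0 es0] := @cov_factor _ _ v0 u;
    first by rewrite ev0 subfield_of_closure_le.
  have [||t _] := ming _ g0.
  - exists L, (j \o v0)%AF; rewrite /galois_in -subfield_of_comp -eg0
      -/(subfield_of v0) ev0.
    exact: galois_closure_field.
  - by exists s0; apply: (@cov_comp_inj _ _ v0); rewrite -eg0 -cov_compA -es0.
  have le_t := dimvS (subvf (t @: {:N})%VS); rewrite dim_aimg in le_t.
  have dv0 : \dim (subfield_of v0) = \dim
    {:subvs_of (fixedField_aspace (core u w))}.
    exact: dim_aimg.
  by rewrite dim_aimg (leq_trans le_t) // -dv0 ev0.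
apply: (isog_trans isoG).
apply: (isog_trans (gal_transfer_isog j' (j \o v)%AF (cov_field g))).
rewrite isog_sym; have := closure_isog suw; rewrite eN eK; exact.
Qed.

End Ambient.

End Coverings.

(** * Locating one step of a decomposition *)

Section Switch.
Variables (k : fieldType) (Xt : curve k).

Lemma dec_all_and (P Q : forall Z W : curve k, covering Z W -> Prop)
    (Z W : curve k)
    (d : decomposition Z W) :
  dec_all P d -> dec_all Q d -> dec_all (fun Z W c => P Z W c /\ Q Z W c) d.
Proof.
elim: d => [W0 c | W0 U c d IH] //=.
by case=> Pc Pd [Qc Qd]; split; last exact: IH.
Qed.

Variables (L : splittingFieldType (ratfun k)) (j : 'AHom(Xt, L)).

(** A property that holds at the base of the tower and fails at its top changes across some step;
    the recursion finds the one nearest the base. *)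
Lemma decomposition_switch (P : forall Z W : curve k, covering Z W -> Prop)
    (Z W : curve k) (d : decomposition Z W) (u : covering Xt Z)
    (Phi : {group gal_of (j @: {:Xt})%AS} -> bool) :
    dec_all P d -> Phi (subgroup_of j (cov_comp (dec_comp d) u)) ->
    ~~ Phi (subgroup_of j u) ->
  exists (V U : curve k) (c : covering V U) (v : covering Xt V),
    [/\ P V U c, Phi (subgroup_of j (cov_comp c v)), ~~ Phi (subgroup_of j v) &
      subgroup_of j u \subset subgroup_of j v].
Proof.
elim: d => [W0 c Pc | W0 U c d IH /= [Pc Pd]] h1 h2.
  by exists Z, W0, c, u.
rewrite -cov_compA in h1.
have [/IH | hd] := boolP (Phi (subgroup_of j (cov_comp (dec_comp d) u)));
  first exact.
by exists U, W0, c, (cov_comp (dec_comp d) u); split=> //;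
  apply: subgroup_of_comp_sub.
Qed.

End Switch.

(** * The subcover attached to [N <*> Q] *)

Section Main.
Variables (k : fieldType) (L : splittingFieldType (ratfun k)).
Variables (Xt : curve k) (j : 'AHom(Xt, L)).
Local Notation Om := (j @: {:Xt})%AS.
Local Notation A := 'Gal(Om / 1%AS)%G.
Hypothesis galOm : galois 1%AS Om.
Variables (X Y : curve k) (f : covering X (P1 k)) (h : covering Y (P1 k)).
Variables (uX : covering Xt X) (uY : covering Xt Y).
Local Notation N := (gcore_group (subgroup_of j uY) A).
Hypothesis pqN : proper_solvable_mod A N.

Lemma subgroup_of_sub (Z : curve k) (u : covering Xt Z) :
  subgroup_of j u \subset A.
Proof. exact/galS/sub1v. Qed.

Lemma normal_N : N <| A.
Proof. exact/gcore_normal/subgroup_of_sub. Qed.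

(** [f'] is attached to [N <*> Q], which has the same core [N] as the group of [uY], hence the same
    closure as [h]. It factors through the curve of [N <*> P], whose monodromy is a proper quotient
    of [A / N]; [joing_maximal] makes the other factor indecomposable, and [f'] itself when
    [N <*> P = A]. *)
Lemma subcover_of_switch (V U : curve k) (c : covering V U)
    (v : covering Xt V) :
    indecomposable c -> subgroup_of j uX \subset subgroup_of j v ->
    ~~ (gcore (N <*> subgroup_of j (cov_comp c v)) A \subset N) ->
    gcore (N <*> subgroup_of j v) A \subset N ->
  exists (X' : curve k) (f' : covering X' (P1 k)),
    [/\ subcover f' f, same_galois_closure f' h,
        solvable_then_indecomposable f' &
        N <*> subgroup_of j (cov_comp c v) = A -> indecomposable f'].
Proof.
move=> indc suXv hP hQ.
set P := subgroup_of j (cov_comp c v) in hP *; set Q := subgroup_of j v in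
  suXv hQ.
have sQP : Q \subset P by apply: subgroup_of_comp_sub.
have sPA : P \subset A by apply: subgroup_of_sub.
have maxQ := (indecomposable_maximal galOm c v).1 indc.
have maxNQ := joing_maximal normal_N sQP sPA maxQ.
pose KQ := fixedField_aspace (N <*> Q); pose KP := fixedField_aspace (N <*> P).
have [uQ eQ] := cov_of_subfield (fixedField_bound (N <*> Q)).
have gQ : subgroup_of j uQ :=: N <*> Q by rewrite /subgroup_of eQ /=
  gal_fixedField.
have [uP eP] := cov_of_subfield (fixedField_bound (N <*> P)).
have gP : subgroup_of j uP :=: N <*> P by rewrite /subgroup_of eP /=
  gal_fixedField.
have [|c2 ec2] := @cov_factor _ _ _ j _ _ uQ uP.
  by rewrite eP eQ fixedFieldS // genS // setUS.
have [|cX _] := @cov_factor _ _ _ j _ _ uX uQ.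
  rewrite eQ -(fixedField_subgroup_of galOm uX) fixedFieldS //.
  by rewrite (subset_trans suXv) // joing_subr.
pose f' := cov_P1 (subvs_of KQ); exists (subvs_of KQ), f'; split.
- exact: subcover_P1 cX.
- pose w := cov_comp h uY; have ew : w = cov_comp f' uQ by apply: cov_P1_unique.
  have ecore : core j uQ w = core j uY w.
    apply/val_inj; rewrite /core subgroup_of_P1.
    change (gcore (subgroup_of j uQ) A = gcore (subgroup_of j uY) A);
      rewrite gQ.
    apply/eqP; rewrite eqEsubset; apply/andP; split.
      exact: hQ.
    rewrite gcore_max ?gcore_norm //.
    exact: joing_subl.
  exists (subvs_of (closure_field j uY w)), (cov_P1 _); split.
    move: (cov_P1 _); rewrite /closure_field -ecore ew => g.
    exact: galois_closure_P1.
  exact: galois_closure_P1.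
- exists (subvs_of KP), (cov_P1 _), c2; split; first exact: cov_P1_unique.
    exists _, (subgroup_of j (cov_comp (cov_P1 _) uP) / core j uP
      (cov_comp (cov_P1 _) uP))%G.
    split; first exact: is_monodromy_P1.
    rewrite /core subgroup_of_P1.
    have nR : gcore_group (subgroup_of j uP) A <| A by rewrite gcore_normal
      ?subgroup_of_sub.
    apply/(solvable_quo_der nR).
    change (solvable_mod (gcore (subgroup_of j uP) A) A); rewrite gP.
    have nR' : gcore_group (N <*> P) A <| A.
      by rewrite gcore_normal // join_subG (normal_sub normal_N).
    have [n hn] := pqN nR' hP; exists n; rewrite (subset_trans hn) //.
    by rewrite join_subG subxx andbT gcore_max ?gcore_norm ?joing_subl.
  apply/(indecomposable_maximal galOm c2 uQ); rewrite -ec2 gP gQ => B.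
  exact: maxNQ.
move=> eA; apply/(indecomposable_maximal galOm f' uQ);
  rewrite subgroup_of_P1 gQ => B sQB sBA.
by have := maxNQ B sQB; rewrite eA; apply.
Qed.

End Main.

(** * Choice of the step of the decomposition for both claims *)

Theorem theorem4p1 (k : fieldType) (hk : [pchar k]%R =i pred0)
  (X : curve k) (f : covering X (P1 k))
  (d : decomposition X (P1 k)) (hd : f = dec_comp d)
  (hindec : dec_all
     (fun (Z W : curve k) (c : covering Z W) => indecomposable c) d)
  (hmon : dec_all
     (fun (Z W : curve k) (c : covering Z W) =>
        exists (gT : finGroupType) (G : {group gT}),
          is_monodromy c G /\ unique_minnormal_solvable_quotient G) d)
  (Xt : curve k) (ft : covering Xt (P1 k)) (hft : galois_closure f ft)
  (Y : curve k) (h : covering Y (P1 k))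
  (hh : minimal_nonsolvable_subcover h ft)
  (gT : finGroupType) (G : {group gT}) (hG : is_monodromy h G)
  (hquo : forall M : {group gT},
     (M <| G)%g -> (M :!=: 1)%g -> solvable (G / M)%g) :
  (exists (X' : curve k) (f' : covering X' (P1 k)),
     [/\ subcover f' f, same_galois_closure f' h &
         solvable_then_indecomposable f'])
  /\
  (dec_all
     (fun (Z W : curve k) (c : covering Z W) => nonsolvable_monodromy c) d ->
   exists (X' : curve k) (f' : covering X' (P1 k)),
     [/\ subcover f' f, same_galois_closure f' h,
         solvable_then_indecomposable f' & indecomposable f']).
Proof.
case: hft => [[L [j galj]] [uX _] minft].
case: hh => [[uY _] [gTn [Gn [monGn nsolGn]]] _].
have galOm : galois 1%AS (j @: {:Xt})%AS.
  by move: galj; rewrite /galois_in cov_field_P1 aimg_one.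
set A := 'Gal((j @: {:Xt})%AS / 1%AS)%G.
set N := gcore_group (subgroup_of j uY) A.
have nN : N <| A := normal_N j uY.
(* Applied both to [G], for its proper quotients, and to [Gn], for nonsolvability. *)
have isoN rT (H : {group rT}) : is_monodromy h H -> H \isog A / N.
  by move/(monodromy_isog galOm uY); rewrite /core subgroup_of_P1.
have pqN : proper_solvable_mod A N := proper_solvable_mod_isog nN (isoN _ _ hG)
  hquo.
have nsN : ~ solvable_mod N A.
  by move/(solvable_mod_isog nN (isoN _ _ monGn)); apply/negP.
have coreA : gcore A A = A.
  by apply/eqP; rewrite eqEsubset gcore_sub gcore_max // normG.
(* As [Xt] is a Galois closure of [f], minimality embeds it in the curve of the closure field; the
   dimensions agree, so the core has order 1. *)
have coreX : gcore (subgroup_of j uX) A = 1.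
  pose w := cov_comp f uX; pose K := closure_field j uX w.
  have [gal0 sub0 _] := galois_closure_P1 galOm (cov_P1 (subvs_of K)).
  have [t _] := minft _ _ gal0 sub0.
  have dimK : \dim (j @: {:Xt}) = \dim K.
    apply/eqP; rewrite eqn_leq (dimvS (fixedField_bound _)) andbT.
    rewrite dim_aimg -(dim_aimg t) (leq_trans (dimvS (subvf _))) //.
    have [v ev] := cov_of_subfield (fixedField_bound (core j uX w)).
    have dv : \dim (subfield_of j v) = \dim {:subvs_of K} by apply: dim_aimg.
    by rewrite -dv ev.
  have := dim_fixedField (core j uX w); rewrite -/K dimK divnn adim_gt0.
  by rewrite /core subgroup_of_P1 => /card1_trivg.
have fA : subgroup_of j (cov_comp (dec_comp d) uX) = A by rewrite -hd
  subgroup_of_P1.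
have AN : ~~ (A \subset N).
  by apply/negP => sAN; apply: nsN; exists 0; rewrite derg0.
have sN V (v : covering Xt V) : subgroup_of j v \subset A by apply: galS;
  apply: sub1v.
have mon_pq (Z W : curve k) (c : covering Z W) :
    (exists (gT : finGroupType) (G : {group gT}),
      is_monodromy c G /\ unique_minnormal_solvable_quotient G) ->
    forall v : covering Xt Z, proper_solvable_mod
      (subgroup_of j (cov_comp c v)) (core j v (cov_comp c v)).
  case=> rT [H [monH /solvable_quo_unique_minnormal solH]] v.
  by apply: proper_solvable_mod_isog solH;
    [apply/gcore_normal/subgroup_of_comp_sub | apply: monodromy_isog].
have pqd : dec_all (fun (Z W : curve k) (c : covering Z W) =>
    forall v : covering Xt Z, proper_solvable_mod
      (subgroup_of j (cov_comp c v)) (core j v (cov_comp c v))) d.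
  elim: d hmon {hd hindec fA} => [W c | W U c d' IH] /=.
    exact: mon_pq.
  by case=> /mon_pq pqc /IH.
(* At the step where the core first falls into [N], [gcore_joing_sub] keeps it there after joining
   [N]; the group of [uX] is contained in the one found. *)
have noncover : gcore (N <*> subgroup_of j uX) A \subset N.
  have [||V [U [c [v [pqc hP hQ suXv]]]]] := @decomposition_switch _ _ _ j _ _
    _ d uX (fun B => ~~ (gcore B A \subset N)) pqd.
  - by rewrite fA coreA.
  - by rewrite negbK coreX sub1G.
  have := gcore_joing_sub nN pqN nsN (subgroup_of_comp_sub j c v) (sN _ _)
    (pqc v) hP.
  rewrite negbK in hQ => /(_ hQ); apply: subset_trans.
  rewrite gcore_max ?gcore_norm // (subset_trans (gcore_sub _ _)) //.
  by rewrite genS // setUS.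
have coverA : N <*> A = A by apply/joing_idPr/normal_sub.
split.
  (* The step sought is the one where the core of [N <*> B] falls into [N]. *)
  have [||V [U [c [v [indc hP hQ suXv]]]]] := @decomposition_switch _ _ _ j _ _
    _ d uX (fun B => ~~ (gcore (N <*> B) A \subset N)) hindec.
  - by rewrite fA coverA coreA.
  - by rewrite negbK.
  rewrite negbK in hQ.
  have [X' [f' [? ? ? _]]] := subcover_of_switch galOm f h pqN indc suXv hP hQ.
  by exists X', f'.
(* Now the step is the one where [N <*> B] ceases to be [A]. Since [c] has nonsolvable monodromy,
   [joing_eq_of_gcore] forces the core into [N] at that same step. *)
move=> hns; have [||V [U [c [v [[indc ns] hP hQ suXv]]]]] :=
  @decomposition_switch _ _ _ j _ _ _ d uX (fun B => N <*> B == A)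
  (dec_all_and hindec hns).
- by rewrite fA coverA.
- by apply: contraNneq AN => eA; move: noncover; rewrite eA coreA.
have eA := eqP hP; have sQP := subgroup_of_comp_sub j c v.
have nsc : ~ solvable_mod (core j v (cov_comp c v))
  (subgroup_of j (cov_comp c v)).
  case: ns => rT [H [/(monodromy_isog galOm v) isoH /negP nsH]].
  by move/(solvable_mod_isog (gcore_normal sQP) isoH).
have cN : gcore (N <*> subgroup_of j v) A \subset N.
  apply/negPn/negP => /(joing_eq_of_gcore nN pqN sQP (sN _ _)).
  move/(_ ((indecomposable_maximal galOm c v).1 indc) nsc eA) => e.
  by rewrite e eqxx in hQ.
have [|X' [f' [? ? ? f'indec]]] := subcover_of_switch galOm f h pqN indc suXv
  _ cN.
  by rewrite eA coreA.
by exists X', f'; split=> //; apply: f'indec.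
Qed.
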